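(* Let $n\ge2$ be an integer and let $\hbar\in\omega^n$ be a constant function. Then $\hbar$ is $0$-generating if and only if the constant zero function $\mathbf 0:n\to\{0\}$ belongs to $\hbar^{(\omega]}=\bigcup_{m\in\omega}\hbar^{(m]}$.
   Context: Identify $n=\{0,\dots,n-1\}$; $\omega^n$ is the set of functions $n\to\omega=\{0,1,\dots\}$ with pointwise addition; $1_i$ is the indicator of $\{i\}$; for $J\subset n$, $\bar 1_J$ is the indicator of $J$, and $n\setminus k=\{k,\dots,n-1\}$. For $\hbar\in\omega^n$, ${\downarrow}\hbar=\{g\in\omega^n:g(i)<\hbar(i)\ \forall i\}$; for $A_i\subset\omega^n$, $\sum_{i\in n}A_i=\{\sum_ia_i:a_i\in A_i\}$; for $A\subset\omega^n$ and $k\in\omega$, $\sum^kA$ is the sumset of $k$ copies of $A$, with $\sum^0A=\{\mathbf 0\}$. $\Sigma_n$ is the group of permutations of $n$. Define $\hbar^{[0]}(i)=\hbar^{\{0\}}(i)=\{1_i\}$, $\hbar^{\{m+1\}}(i)=\{x-x(i)1_i:x\in({\downarrow}\hbar)\cap\sum_{j\in n}\hbar^{[m]}(j)\}$, $\hbar^{[m+1]}(i)=\hbar^{\{m+1\}}(i)\cup\hbar^{[m]}(i)$, $\hbar^{[\omega]}(i)=\bigcup_m\hbar^{\{m\}}(i)$; $\hbar$ is $0$-generating if the zero function lies in $\bigcup_{i\in n}\hbar^{[\omega]}(i)$. Also define $\hbar^{(0]}=\emptyset$ and, for $m\in\omega$, $\hbar^{(m+1]}=\hbar^{(m]}\cup\{(x-x(n-1)\cdot1_{n-1})\circ\sigma:\sigma\in\Sigma_n,\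 x\in({\downarrow}\hbar)\cap\bigcup_{0\le k<n}(\bar 1_{n\setminus k}+\sum^k\hbar^{(m]})\}$. *)

(* Defs.v *)
From HB Require Import structures.
From mathcomp Require Import all_boot all_order all_fingroup all_algebra.
From mathcomp Require Import mathcomp_extra boolp classical_sets.

Set Implicit Arguments.
Unset Strict Implicit.
Unset Printing Implicit Defensive.

Import GRing.Theory.
Local Open Scope classical_set_scope.
Local Open Scope ring_scope.

(* omega^n with its pointwise addition, inherited from the nmodType nat. *)
Notation "'omega^' n" := {ffun 'I_n -> nat} (at level 8, n at level 2).

Definition indicator (n : nat) (J : pred 'I_n) : omega^n :=
  [ffun j => nat_of_bool (J j)].

Definition single (n : nat) (i : 'I_n) : omega^n := indicator (pred1 i).

Definition below (n : nat) (h : omega^n) : set (omega^n) :=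
  [set g : omega^n | forall i, (g i < h i)%N].

Definition sumset (n k : nat) (A : 'I_k -> set (omega^n)) : set (omega^n) :=
  [set \sum_(j < k) a j | a in [set a | forall j, A j (a j)]].

Definition sumset_pow (n k : nat) (A : set (omega^n)) : set (omega^n) :=
  sumset (fun _ : 'I_k => A).

(* x - x(i) 1_i.  The coordinate is a natural number so that i = n.-1 makes
   sense for every n; nothing is erased when n <= i. *)
Definition erase (n : nat) (i : nat) (x : omega^n) : omega^n :=
  [ffun j : 'I_n => if j == i :> nat then 0%N else x j].

Definition gen_step (n : nat) (h : omega^n) (F : 'I_n -> set (omega^n))
    (i : 'I_n) : set (omega^n) :=
  [set erase i x | x in below h `&` sumset F].

(* h^[m](i); the left operand of the union is gen_at h m i. *)
Fixpoint gen_upto (n : nat) (h : omega^n) (m : nat) (i : 'I_n) :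
    set (omega^n) :=
  if m is m'.+1 then gen_step h (gen_upto h m') i `|` gen_upto h m' i
  else [set single i].

(* h^{m}(i) *)
Definition gen_at (n : nat) (h : omega^n) (m : nat) (i : 'I_n) :
    set (omega^n) :=
  if m is m'.+1 then gen_step h (gen_upto h m') i else [set single i].

(* h^[omega](i) *)
Definition gen_omega (n : nat) (h : omega^n) (i : 'I_n) : set (omega^n) :=
  \bigcup_(m in [set: nat]) gen_at h m i.

Definition zero_generating (n : nat) (h : omega^n) : Prop :=
  (\bigcup_(i in [set: 'I_n]) gen_omega h i) 0.

(* The union over 0 <= k < n of the indicator of {k, ..., n-1} plus the
   k-fold sumset of A. *)
Definition tail_sumset (n : nat) (A : set (omega^n)) : set (omega^n) :=
  \bigcup_(k in [set: 'I_n])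
    [set indicator (fun j : 'I_n => (k <= j)%N) + y | y in sumset_pow k A].

Definition permute (n : nat) (s : 'S_n) (x : omega^n) : omega^n :=
  [ffun i => x (s i)].

(* h^(m] *)
Fixpoint sym_upto (n : nat) (h : omega^n) (m : nat) : set (omega^n) :=
  if m is m'.+1 then
    sym_upto h m' `|`
    [set permute s (erase n.-1 x) |
       s in [set: 'S_n] & x in below h `&` tail_sumset (sym_upto h m')]
  else set0.

(* h^(omega] *)
Definition sym_omega (n : nat) (h : omega^n) : set (omega^n) :=
  \bigcup_(m in [set: nat]) sym_upto h m.

(* Main.v *)
(* Order [omega^n] pointwise.  For constant [h], every element of [sym_upto h m]
   lies above an element of [gen_upto h m i] for every [i], and conversely every
   element [y] of [gen_upto h m i] with [y i = 0] lies above an element of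
   [sym_upto h m].  Both are inductions on [m]; since only the zero function lies
   below the zero function, they give the two implications.

   For [y] obtained from a symmetric step and an index [i], either [y i > 0] and
   [y] is above [single i], or [y i = 0] and the permutation producing [y] can be
   corrected by a transposition of two zeros of [y], so that [i] is the erased
   place.  For [y = erase i (\sum_j a j)] obtained from an ordinary step, either
   [a i i = 0] and [y] is above [a i], or [i] belongs to [J = {j | a j j > 0}] and
   a permutation moving [J] to a final segment and [i] to the last place turns
   the step into a symmetric one. *)
Require Import Defs.
From HB Require Import structures.
From mathcomp Require Import all_boot all_order all_fingroup all_algebra.
From mathcomp Require Import mathcomp_extra boolp classical_sets.

Set Implicit Arguments.
Unset Strict Implicit.
Unset Printing Implicit Defensive.

Import GRing.Theory.
Local Open Scope classical_set_scope.
Local Open Scope ring_scope.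

Definition le_fun (n : nat) (x y : omega^n) : Prop :=
  forall i, (x i <= y i)%N.

Lemma le_fun_refl (n : nat) (x : omega^n) : le_fun x x.
Proof. by move=> i. Qed.

Lemma le_fun_trans (n : nat) (y x z : omega^n) :
  le_fun x y -> le_fun y z -> le_fun x z.
Proof. by move=> xy yz i; apply: leq_trans (yz i). Qed.

Lemma le_fun0 (n : nat) (x : omega^n) : le_fun x 0 -> x = 0.
Proof.
by move=> x0; apply/ffunP=> i; have := x0 i; rewrite ffunE leqn0 => /eqP.
Qed.

Lemma le_fun_below (n : nat) (h x y : omega^n) :
  le_fun x y -> below h y -> below h x.
Proof. by move=> xy hy i; apply: leq_ltn_trans (hy i). Qed.

Lemma le_single (n : nat) (i : 'I_n) (x : omega^n) :
  (0 < x i)%N -> le_fun (single i) x.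
Proof. by move=> xi j; rewrite ffunE /=; case: eqP => // ->. Qed.

Lemma le_erase (n i : nat) (x y : omega^n) :
  le_fun x y -> le_fun (erase i x) (erase i y).
Proof. by move=> xy j; rewrite !ffunE; case: ifP. Qed.

Lemma le_sum (n : nat) (I : finType) (F G : I -> omega^n) :
  (forall j, le_fun (F j) (G j)) -> le_fun (\sum_j F j) (\sum_j G j).
Proof.
move=> FG p; rewrite !sum_ffunE.
by apply: (big_ind2 (fun u v : nat => (u <= v)%N)) => // *; [exact: leq_add|exact: FG].
Qed.

Lemma le_sum_term (n : nat) (I : finType) (F : I -> omega^n) (i : I) :
  le_fun (F i) (\sum_j F j).
Proof. by move=> p; rewrite (bigD1 i) //= ffunE leq_addr. Qed.

Lemma permute_comp (n : nat) (s t : 'S_n) (x : omega^n) :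
  permute s (permute t x) = permute (s * t) x.
Proof. by apply/ffunP=> i; rewrite !ffunE permM. Qed.

Lemma permute1 (n : nat) (x : omega^n) : permute 1 x = x.
Proof. by apply/ffunP=> i; rewrite !ffunE perm1. Qed.

Lemma permute_erase (n : nat) (s : 'S_n) (i : 'I_n) (x : omega^n) :
  permute s (erase (s i) x) = erase i (permute s x).
Proof. by apply/ffunP=> j; rewrite !ffunE !val_eqE (inj_eq perm_inj). Qed.

Lemma permute_single (n : nat) (s : 'S_n) (i : 'I_n) :
  permute s (single (s i)) = single i.
Proof. by apply/ffunP=> j; rewrite !ffunE /= (inj_eq perm_inj). Qed.

Lemma permute_sum (n : nat) (s : 'S_n) (I : finType) (F : I -> omega^n) :
  permute s (\sum_j F j) = \sum_j permute s (F j).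
Proof.
by apply/ffunP=> i; rewrite ffunE !sum_ffunE; apply: eq_bigr => j _; rewrite ffunE.
Qed.

Lemma permute_tperm (n : nat) (i j : 'I_n) (x : omega^n) :
  x i = x j -> permute (tperm i j) x = x.
Proof. by move=> xij; apply/ffunP=> p; rewrite ffunE; case: tpermP => // ->. Qed.

Lemma below_permute (n : nat) (h : omega^n) (s : 'S_n) (x : omega^n) :
  (exists c : nat, forall i, h i = c) -> below h x -> below h (permute s x).
Proof. by case=> c hc hx i; have := hx (s i); rewrite ffunE !hc. Qed.

(** The tail indicator plus a [k]-fold sum, spread out with one summand per place as in [sumset F],
    so that symmetric and ordinary steps can be compared term by term. *)
Definition tail_sum (n k : nat) (f : 'I_n -> omega^n) : omega^n :=
  \sum_(j < n) (if (j < k)%N then f j else single j).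

Lemma tail_sumE (n k : nat) (hk : (k <= n)%N) (f : 'I_n -> omega^n) :
  tail_sum k f = indicator (fun j : 'I_n => (k <= j)%N)
    + \sum_(j < k) f (widen_ord hk j).
Proof.
rewrite /tail_sum (bigID (fun j : 'I_n => (j < k)%N)) /= addrC; congr (_ + _).
  apply/ffunP=> p; rewrite ffunE sum_ffunE.
  case: (leqP k p) => kp.
    rewrite (bigD1 p) -?leqNgt //= ltnNge kp /= ffunE /= eqxx.
    rewrite big1 // => j /andP[kj jp].
    by rewrite (negPf kj) ffunE /= eq_sym (negPf jp).
  rewrite big1 // => j kj; rewrite (negPf kj) ffunE /=.
  by case: eqP => // pj; rewrite -pj kp in kj.
rewrite (big_ord_narrow hk).
by apply: eq_bigr => j _ /=; rewrite ltn_ord.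
Qed.

Lemma tail_sumsetP (n : nat) (A : set (omega^n)) (x : omega^n) :
  tail_sumset A x <->
  exists (k : 'I_n) (f : 'I_n -> omega^n),
    (forall j : 'I_n, (j < k)%N -> A (f j)) /\ x = tail_sum k f.
Proof.
split=> [[k _ [y [a Aa <-] <-]]|[k [f [Af ->]]]].
  (* [tail_sum k f] never reads [f] from place [k] on, so the default [0] is harmless. *)
  exists k, (fun j => if insub (val j) is Some l then a l else 0); split=> [j jk|].
    by rewrite insubT.
  rewrite (tail_sumE (ltnW (ltn_ord k))); congr (_ + _).
  by apply: eq_bigr => l _ /=; rewrite valK.
rewrite (tail_sumE (ltnW (ltn_ord k))); exists k => //.
eexists; last by [].
by exists (fun j => f (widen_ord (ltnW (ltn_ord k)) j)) => // j; apply: Af; exact: (ltn_ord j).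
Qed.

Lemma permute_tail_sum (n k : nat) (s : 'S_n) (f : 'I_n -> omega^n) :
  permute s (tail_sum k f) =
  \sum_(j < n) (if (s j < k)%N then permute s (f (s j)) else single j).
Proof.
rewrite permute_sum (reindex_inj (@perm_inj _ s)) /=.
by apply: eq_bigr => j _; case: ifP => // _; rewrite permute_single.
Qed.

(** A further permutation is absorbed into the one that ends the step. *)
Lemma sym_upto_permute (n : nat) (h : omega^n) (m : nat) (s : 'S_n) (x : omega^n) :
  sym_upto h m x -> sym_upto h m (permute s x).
Proof.
elim: m => //= m IH [/IH|[t _ [y hy <-]]]; first by left.
by right; rewrite permute_comp; exists (s * t)%g => //; exists y.
Qed.

(** Listing the complement of [J] before [J] sends [J] to a final segment; a swap inside that
    segment then puts [i] last. *)
Lemma perm_to_final_segment (n : nat) (J : {set 'I_n.+1}) (i : 'I_n.+1) :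
  i \in J ->
  exists (s : 'S_n.+1) (k : 'I_n.+1),
    s i = ord_max /\ forall j, (s j < k)%N = (j \notin J).
Proof.
move=> iJ; pose l := enum (~: J) ++ enum J.
have lP j : j \in l by rewrite mem_cat !mem_enum inE orNb.
have size_l : size l = n.+1.
  by rewrite size_cat -!cardE addnC cardsC card_ord.
have idx_lt j : (index j l < n.+1)%N by have := lP j; rewrite -index_mem size_l.
have idx_inj : injective (fun j => Ordinal (idx_lt j)).
  by move=> j j' [/(congr1 (nth ord0 l))]; rewrite !nth_index.
pose s0 := perm idx_inj.
have k_lt : (#|~: J| < n.+1)%N.
  rewrite -[X in (_ < X)%N]card_ord -(cardsC J) -[X in (X < _)%N]add0n.
  by rewrite ltn_add2r card_gt0; apply/set0Pn; exists i.
have s0P j : (s0 j < #|~: J|)%N = (j \notin J).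
  rewrite permE /= index_cat mem_enum inE; case: ifP => jJ.
    by rewrite cardE index_mem mem_enum inE jJ.
  by rewrite -cardE ltnNge leq_addr.
exists (s0 * tperm (s0 i) ord_max)%g, (Ordinal k_lt).
split=> [|j /=]; first by rewrite permM tpermL.
(* The swapped places [s0 i] and [ord_max] are both at least [#|~: J|], so the swap respects the
   cut. *)
by rewrite permM -s0P; case: tpermP => // ->; rewrite s0P iJ /= ltnNge -ltnS k_lt.
Qed.

Lemma gen_upto_single (n : nat) (h : omega^n) (m : nat) (i : 'I_n) :
  gen_upto h m i (single i).
Proof. by elim: m => //= m; right. Qed.

Lemma sym_upto_ge_gen (n : nat) (h : omega^n.+1) (m : nat) (y : omega^n.+1)
    (i : 'I_n.+1) :
  (exists c : nat, forall j, h j = c) ->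
  sym_upto h m y -> exists2 g, gen_upto h m i g & le_fun g y.
Proof.
move=> hc; elim: m y i => //= m IH y i [/IH -/(_ i)[g Gg gy]|]; first by exists g; [right|].
case=> s _ [x [hx /tail_sumsetP[k [f [Sf xE]]]] yE].
have [yi|] := ltnP 0 (y i).
  by exists (single i); [right; exact: gen_upto_single|exact: le_single].
rewrite leqn0 => /eqP yi0.
pose t := (s * tperm (s i) ord_max)%g.
have ti : t i = ord_max by rewrite permM tpermL.
have {}yE : y = erase i (permute t x).
  (* [erase n x] vanishes at [ord_max] by erasure and at [s i] because [y i = 0], so the
     transposition fixes it. *)
  rewrite -permute_erase ti -permute_comp permute_tperm ?yE //.
  by move: yi0; rewrite -yE !ffunE /= eqxx.
(* The induction hypothesis holds at every index, so it is applied to the summand at place [j] with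
   index [j] itself. *)
have /choice[g gP] (j : 'I_n.+1) : exists g, gen_upto h m j g /\
    le_fun g (if (t j < k)%N then permute t (f (t j)) else single j).
  case: ifP => [/Sf/(sym_upto_permute t)/(IH _ j)[g Gg gy]|_]; first by exists g.
  by exists (single j); split; [exact: gen_upto_single|exact: le_fun_refl].
have g_le : le_fun (\sum_j g j) (permute t x).
  by rewrite xE permute_tail_sum; apply: le_sum => j; case: (gP j).
exists (erase i (\sum_j g j)); last by rewrite yE; exact: le_erase.
left; exists (\sum_j g j) => //; split.
  by apply: le_fun_below g_le _; exact: below_permute.
by exists g => // j; case: (gP j).
Qed.

Lemma gen_upto_ge_sym (n : nat) (h : omega^n.+1) (m : nat) (y : omega^n.+1)
    (i : 'I_n.+1) :
  (exists c : nat, forall j, h j = c) ->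
  gen_upto h m i y -> y i = 0%N -> exists2 z, sym_upto h m z & le_fun z y.
Proof.
move=> hc; elim: m y i => [|m IH] y i /=.
  by move=> ->; rewrite ffunE /= eqxx.
case=> [[x [hx [a Ga xE]] yE] _|Gy yi0]; last first.
  by have [z Sz zy] := IH _ _ Gy yi0; exists z; [left|].
have [ai|ai] := posnP (a i i).
  have [z Sz za] := IH _ _ (Ga i) ai; exists z; first by left.
  apply: le_fun_trans za _ => j; rewrite -yE ffunE.
  case: ifPn => [/eqP/val_inj ->|_]; first by rewrite ai.
  by rewrite -xE; exact: le_sum_term.
have iJ : i \in [set j | (0 < a j j)%N]%SET by rewrite inE.
have [s [k [si sk]]] := perm_to_final_segment iJ.
have {}sk j : (s j < k)%N = (a j j == 0%N) by rewrite sk inE -eqn0Ngt.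
have /choice[b bP] (j : 'I_n.+1) :
    exists b, (s j < k)%N -> sym_upto h m b /\ le_fun b (a j).
  (* If [a j j > 0], the summand will be bounded below by [single j] instead, so [b] takes a dummy
     value. *)
  rewrite sk; have [aj|_] := eqVneq; last by exists 0.
  by have [b Sb ba] := IH _ _ (Ga j) aj; exists b.
(* [s] is undone in advance, so that [permute s] turns the term at [s j] into [b j]. *)
pose f l := permute s^-1 (b ((s^-1)%g l)).
have x_le : le_fun (permute s (tail_sum k f)) x.
  rewrite permute_tail_sum -xE; apply: le_sum => j.
  case: ifPn => [/bP[_ ba]|]; last by rewrite sk -lt0n; exact: le_single.
  by rewrite /f permute_comp mulgV permute1 permK.
exists (permute s (erase n (tail_sum k f))); last first.
  have := permute_erase s i (tail_sum k f); rewrite si /= => ->.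
  by rewrite -yE; exact: le_erase.
right; exists s => //; exists (tail_sum k f) => //; split.
  (* As [h] is constant, the bound on [permute s (tail_sum k f)] passes to [tail_sum k f] through
     [s^-1]. *)
  rewrite -[tail_sum k f]permute1 -(mulVg s) -permute_comp.
  by apply: below_permute => //; exact: le_fun_below x_le hx.
apply/tail_sumsetP; exists k, f; split=> // l lk.
by apply: sym_upto_permute; case: (bP ((s^-1)%g l)) => //; rewrite permKV.
Qed.

(** Whatever a cumulative stage contains entered it through some [gen_at]. *)
Lemma gen_omegaP (n : nat) (h : omega^n) (i : 'I_n) (x : omega^n) :
  gen_omega h i x <-> exists m, gen_upto h m i x.
Proof.
split=> [[[|m] _ Gx]|[m]]; first by exists 0%N.
  by exists m.+1; left.
elim: m => [Gx|m IH [Gx|//]]; first by exists 0%N.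
by exists m.+1.
Qed.

Theorem theorem3p1 (n : nat) (hn : (2 <= n)%N) (h : omega^n)
    (hconst : exists c : nat, forall i : 'I_n, h i = c) :
  zero_generating h <-> sym_omega h 0.
Proof.
case: n hn h hconst => // n _ h hconst; split=> [[i _ /gen_omegaP[m G0]]|[m _ S0]].
  have [|z Sz /le_fun0 z0] := gen_upto_ge_sym hconst G0; first by rewrite ffunE.
  by exists m; rewrite -?z0.
(* The comparison holds at every index; [ord0] is an arbitrary choice. *)
have [g Gg /le_fun0 g0] := sym_upto_ge_gen ord0 hconst S0.
by exists ord0 => //; apply/gen_omegaP; exists m; rewrite -g0.
Qed.
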